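(* Let $G$ be a torsion-free, locally nilpotent group. (1) If $H$ is any finite-index subgroup of $G$, then the natural restriction map $\mathrm{LO}(G) \to \mathrm{LO}(H)$ is a bijection. (2) Therefore, there is a natural action of $\mathrm{Comm}(G)$ on $\mathrm{LO}(G)$: if $\alpha \in \mathrm{Comm}(G)$ is represented by a commensuration $\phi\colon G_1 \to G_2$, then $\alpha$ acts by the composition $\mathrm{LO}(G) \to \mathrm{LO}(G_1) \to \mathrm{LO}(G_2) \to \mathrm{LO}(G)$, where the first map is restriction, the second is the bijection induced by the isomorphism $\phi$, and the third is the inverse of restriction; this is well defined (independent of the representative $\phi$) and is a group action.
   Context: A left-invariant order on a group $G$ is a (strict) total order $\prec$ on $G$ such that $x \prec y \Rightarrow gx \prec gy$ for all $x,y,g \in G$; $\mathrm{LO}(G)$ is the set of all of them. An isomorphism $\phi\colon G_1 \to G_2$ induces a bijection $\mathrm{LO}(G_1)\to\mathrm{LO}(G_2)$, sending $\prec$ to the order $\prec^\phi$ defined by $\phi(x) \prec^\phi \phi(y) \iff x \prec y$. A commensuration of $G$ is an isomorphism $\phi \colon G_1 \to G_2$, where $G_1$ and $G_2$ are finite-index subgroups of $G$. Two commensurations $\phi \colon G_1 \to G_2$ and $\phi' \colon G_1' \to G_2'$ are equivalent if there is a finite-index subgroup $H$ of $G_1 \cap G_1'$ such that $\phi$ and $\phi'$ have the same restriction to $H$. The equivalence classes of commensurations form a group $\mathrm{Comm}(G)$ (the abstract commensurator), with multiplication given by composition restricted to a finite-index subgroup where it is defined. Elements of $\mathrm{Comm}(G)$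 are written as acting on the right (so $\alpha\beta$ means first $\alpha$, then $\beta$, and the action is a right action). A group is locally nilpotent if each of its finitely generated subgroups is nilpotent. *)

(* Defs.v *)
From HB Require Import structures.
From mathcomp Require Import all_boot.
From mathcomp Require Import boolp classical_sets functions cardinality.

Set Implicit Arguments.
Unset Strict Implicit.
Unset Printing Implicit Defensive.

Local Open Scope classical_set_scope.
Local Open Scope quotient_scope.
Local Open Scope group_scope.

Definition is_subgroup (G : groupType) (H : set G) : Prop :=
  group_closed (fun x => x \in H).

Record subgroup (G : groupType) := Subgroup {
  sg_set :> set G;
  sg_closed : is_subgroup sg_set }.

Record sg_type (G : groupType) (H : subgroup G) := SgType {
  sg_val : G;
  sg_valP : sg_val \in sg_set H }.

HB.instance Definition _ (G : groupType) (H : subgroup G) :=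
  [isSub for @sg_val G H].
HB.instance Definition _ (G : groupType) (H : subgroup G) :=
  [Choice of sg_type H by <:].
HB.instance Definition _ (G : groupType) (H : subgroup G) :=
  SubChoice_isSubGroup.Build G (fun x => x \in sg_set H) (sg_type H)
    (sg_closed H).

Definition lcoset (G : groupType) (x : G) (H : set G) : set G :=
  [set x * h | h in H].

Definition finite_index_in (G : groupType) (H K : set G) : Prop :=
  H `<=` K /\ finite_set [set lcoset x H | x in K].

Definition finite_index (G : groupType) (H : set G) : Prop :=
  finite_index_in H [set: G].

Definition generated (G : groupType) (A : set G) : set G :=
  smallest (@is_subgroup G) A.

Definition commutator_subgroup (G : groupType) (A B : set G) : set G :=
  generated [set [~ x, y] | x in A & y in B].

Fixpoint lower_central (G : groupType) (K : set G) (n : nat) : set G :=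
  if n is m.+1 then commutator_subgroup (lower_central K m) K else K.

Definition nilpotent_group (G : groupType) (K : set G) : Prop :=
  exists n, lower_central K n = [set 1].

Definition locally_nilpotent (G : groupType) : Prop :=
  forall A : set G, finite_set A -> nilpotent_group (generated A).

Definition torsion_free (G : groupType) : Prop :=
  forall (x : G) (n : nat), x ^+ n.+1 = 1 -> x = 1.

#[local] Obligation Tactic := idtac.

Record LO (G : groupType) := LeftOrder {
  lo_lt :> G -> G -> Prop;
  lo_irr : forall x, ~ lo_lt x x;
  lo_trans : forall x y z, lo_lt x y -> lo_lt y z -> lo_lt x z;
  lo_total : forall x y, x <> y -> lo_lt x y \/ lo_lt y x;
  lo_left : forall x y g, lo_lt x y -> lo_lt (g * x) (g * y) }.

Lemma LO_ext (G : groupType) (o p : LO G) :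
  (forall x y, o x y <-> p x y) -> o = p.
Proof.
case: o p => [r r1 r2 r3 r4] [s s1 s2 s3 s4] /= rs.
have e : r = s by apply/funext=> x; apply/funext=> y; apply/propext.
by case: _ / e s1 s2 s3 s4 => *; congr LeftOrder; apply: Prop_irrelevance.
Qed.

Program Definition LO_res (G : groupType) (H : subgroup G) (o : LO G) :
    LO (sg_type H) :=
  @LeftOrder (sg_type H) (fun x y => o (val x) (val y)) _ _ _ _.
Next Obligation. by move=> G H o x /lo_irr. Qed.
Next Obligation. by move=> G H o x y z; apply: lo_trans. Qed.
Next Obligation.
by move=> G H o x y xy; apply: lo_total => /val_inj.
Qed.
Next Obligation. by move=> G H o x y g; exact: lo_left. Qed.

Record group_iso (G1 G2 : groupType) := GroupIso {
  iso_fun :> {multiplicative G1 -> G2};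
  iso_bij : bijective iso_fun }.

(* Since f is bijective, this is the unique relation p on G2 such that
   p (f x) (f y) <-> o x y: see LO_mapE. *)
Program Definition LO_map (G1 G2 : groupType) (f : group_iso G1 G2) (o : LO G1)
    : LO G2 :=
  @LeftOrder G2 (fun u v => exists x y, [/\ f x = u, f y = v & o x y]) _ _ _ _.
Next Obligation.
move=> G1 G2 f o u [x [y [xu yu]]].
have -> : x = y by apply: (bij_inj (iso_bij f)); rewrite xu yu.
exact: lo_irr.
Qed.
Next Obligation.
move=> G1 G2 f o u v w [x [y [xu yv xy]]] [y' [z [y'v zw yz]]].
exists x, z; split=> //; apply: (lo_trans xy).
suff -> : y = y' by [].
by apply: (bij_inj (iso_bij f)); rewrite yv y'v.
Qed.
Next Obligation.
move=> G1 G2 f o u v uv.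
have [g _ gK] := iso_bij f.
have /(lo_total o)[xy|yx] : g u <> g v.
  by move=> /(can_inj gK).
- by left; exists (g u), (g v); split.
- by right; exists (g v), (g u); split.
Qed.
Next Obligation.
move=> G1 G2 f o u v w [x [y [xu yv xy]]].
have [g _ gK] := iso_bij f.
exists (g w * x), (g w * y); split; rewrite ?gmulfM ?gK ?xu ?yv //.
exact: lo_left.
Qed.

Lemma LO_mapE (G1 G2 : groupType) (f : group_iso G1 G2) (o : LO G1) x y :
  LO_map f o (f x) (f y) <-> o x y.
Proof.
split=> [[x' [y' []]]|xy]; last by exists x, y.
by move=> /(bij_inj (iso_bij f))-> /(bij_inj (iso_bij f))->.
Qed.

Record commensuration (G : groupType) := Commensuration {
  dom : subgroup G;
  cod : subgroup G;
  dom_fi : finite_index dom;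
  cod_fi : finite_index cod;
  comm_iso :> group_iso (sg_type dom) (sg_type cod) }.

Definition comm_equiv (G : groupType) (phi psi : commensuration G) : Prop :=
  exists2 H : subgroup G, finite_index_in H (dom phi `&` dom psi) &
    forall (x : sg_type (dom phi)) (y : sg_type (dom psi)),
      val x = val y -> sg_set H (val x) -> val (phi x) = val (psi y).

HB.instance Definition _ (G : groupType) := gen_eqMixin (commensuration G).
HB.instance Definition _ (G : groupType) := gen_choiceMixin (commensuration G).


Lemma sg1 (G : groupType) (H : subgroup G) : sg_set H 1.
Proof. by apply/set_mem; have [] := sg_closed H. Qed.

Lemma sgV (G : groupType) (H : subgroup G) x : sg_set H x -> sg_set H x^-1.
Proof.
by move=> /mem_set xH; apply/set_mem/(group_closedV (sg_closed H)).
Qed.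

Lemma sgM (G : groupType) (H : subgroup G) x y : sg_set H x -> sg_set H y -> sg_set H (x * y).
Proof.
by move=> /mem_set xH /mem_set yH; apply/set_mem/(group_closedM (sg_closed H)).
Qed.

Lemma is_subgroupP (G : groupType) (H : set G) :
  H 1 -> (forall x y, H x -> H y -> H (x / y)) -> is_subgroup H.
Proof.
move=> H1 HF; split; first exact/mem_set.
by move=> x y /set_mem xH /set_mem yH; apply/mem_set/HF.
Qed.

Lemma eq_lcosetP (G : groupType) (H : subgroup G) x y :
  lcoset x H = lcoset y H <-> sg_set H (x^-1 * y).
Proof.
split=> [e|xy].
  have : lcoset y H y by exists 1; rewrite ?mulg1 //; exact: sg1.
  by rewrite -e => -[h hH <-]; rewrite mulKg.
apply/seteqP; split=> _ [h hH <-] /=.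
- exists ((x^-1 * y)^-1 * h); last by rewrite invgM invgK !mulgA mulgV mul1g.
  by apply/sgM => //; apply: sgV.
- exists (x^-1 * y * h); last by rewrite !mulgA mulgV mul1g.
  exact: sgM.
Qed.

(* H has finite index in K iff its left cosets in K are separated by a map
   with finite image. *)
Lemma finite_index_sepP (G : groupType) (H : subgroup G) (K : set G) :
  H `<=` K ->
  finite_index_in H K <->
  exists (T : Type) (c : G -> T), finite_set (c @` K) /\
    forall x y, K x -> K y -> c x = c y -> sg_set H (x^-1 * y).
Proof.
move=> HK; split=> [[_ fin]|[T [c [fin sep]]]].
  exists (set G), (fun x => lcoset x H); split; first exact: fin.
  by move=> x y _ _ /eq_lcosetP.
split; first exact: HK.
pose r t := xget 1 [set x | K x /\ c x = t].
have rP x : K x -> K (r (c x)) /\ c (r (c x)) = c x.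
  by move=> Kx; rewrite /r; case: xgetP => [y _ //|/(_ x)]; case.
apply: (@sub_finite_set _ _ ((fun t => lcoset (r t) H) @` (c @` K))).
  move=> _ [x Kx <-]; exists (c x); first by exists x.
  have [Kr cr] := rP _ Kx.
  by apply/eq_lcosetP; apply: sep.
exact: finite_image.
Qed.

Lemma finite_index_inT (G : groupType) (H : subgroup G) (K : set G) :
  H `<=` K -> finite_index H -> finite_index_in H K.
Proof.
move=> HK [_ fin]; split=> //; apply: sub_finite_set fin.
exact: image_subset.
Qed.

Lemma finite_index_trans (G : groupType) (H K : subgroup G) :
  finite_index_in H K -> finite_index K -> finite_index H.
Proof.
move=> finH finK; have [HK _] := finH.
have [T [c [cfin csep]]] := (finite_index_sepP HK).1 finH.
have [U [d [dfin dsep]]] := (finite_index_sepP (@subsetT _ K)).1 finK.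
apply/finite_index_sepP; first exact: subsetT.
pose r t := xget 1 [set x | d x = t].
have rP x : d (r (d x)) = d x.
  by rewrite /r; case: xgetP => [y _ //|/(_ x)]; case.
have Kr x : sg_set K ((r (d x))^-1 * x) by apply: dsep.
exists (U * T)%type, (fun x => (d x, c ((r (d x))^-1 * x))); split.
  apply: (@sub_finite_set _ _ ((d @` setT) `*` (c @` K))).
    move=> _ [x _ <-]; split=> /=; first by exists x.
    by exists ((r (d x))^-1 * x).
  exact: finite_setX.
move=> x y _ _ [dxy cxy].
have := csep _ _ (Kr x) (Kr y) cxy.
by rewrite dxy invgM invgK mulgA mulgK.
Qed.

Lemma finite_index_sub (G : groupType) (H K : subgroup G) :
  H `<=` K -> finite_index H -> finite_index K.
Proof.
move=> HK finH.
have [T [c [cfin csep]]] := (finite_index_sepP (@subsetT _ H)).1 finH.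
apply/finite_index_sepP; first exact: subsetT.
by exists T, c; split=> // x y _ _ /csep xy; apply/HK/xy.
Qed.

Lemma subgroupI_subproof (G : groupType) (H K : subgroup G) :
  is_subgroup (H `&` K).
Proof.
apply: is_subgroupP => [|x y [Hx Kx] [Hy Ky]]; first by split; apply: sg1.
by split; apply: sgM => //; apply: sgV.
Qed.

Definition subgroupI (G : groupType) (H K : subgroup G) : subgroup G :=
  Subgroup (subgroupI_subproof H K).

Lemma finite_indexI (G : groupType) (H K : subgroup G) :
  finite_index H -> finite_index K -> finite_index (subgroupI H K).
Proof.
move=> finH finK.
have [T [c [cfin csep]]] := (finite_index_sepP (@subsetT _ H)).1 finH.
have [U [d [dfin dsep]]] := (finite_index_sepP (@subsetT _ K)).1 finK.
apply/finite_index_sepP; first exact: subsetT.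
exists (T * U)%type, (fun x => (c x, d x)); split.
  apply: (@sub_finite_set _ _ ((c @` setT) `*` (d @` setT))).
    by move=> _ [x _ <-]; split; exists x.
  exact: finite_setX.
by move=> x y _ _ [cxy dxy]; split; [apply: csep|apply: dsep].
Qed.

Lemma subgroupT_subproof (G : groupType) : is_subgroup [set: G].
Proof. exact: is_subgroupP. Qed.

Definition subgroupT (G : groupType) : subgroup G :=
  Subgroup (@subgroupT_subproof G).

Lemma finite_indexT (G : groupType) : finite_index (subgroupT G).
Proof.
apply/finite_index_sepP; first exact: subsetT.
by exists unit, (fun=> tt).
Qed.

(* The underlying map of phi, extended by 1 outside of its domain. *)
Definition cfun (G : groupType) (phi : commensuration G) (x : G) : G :=
  if insub x is Some u then val (phi u) else 1.

Section Cfun.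
Context (G : groupType) (phi : commensuration G).

Lemma cfunE (u : sg_type (dom phi)) : cfun phi (val u) = val (phi u).
Proof. by rewrite /cfun valK. Qed.

Lemma domP x : sg_set (dom phi) x -> exists u : sg_type (dom phi), val u = x.
Proof. by move=> /mem_set xD; exists (SgType xD). Qed.

Lemma cfun_cod x : sg_set (dom phi) x -> sg_set (cod phi) (cfun phi x).
Proof. by move=> /domP[u <-]; rewrite cfunE; apply/set_mem/valP. Qed.

Lemma cfunM x y : sg_set (dom phi) x -> sg_set (dom phi) y ->
  cfun phi (x * y) = cfun phi x * cfun phi y.
Proof.
move=> /domP[u <-] /domP[v <-].
have -> : val u * val v = val (u * v) by [].
by rewrite !cfunE gmulfM.
Qed.

Lemma cfun1 : cfun phi 1 = 1.
Proof.
apply: (mulgI (cfun phi 1)); rewrite -cfunM ?mulg1 //; exact: sg1.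
Qed.

Lemma cfunV x : sg_set (dom phi) x -> cfun phi x^-1 = (cfun phi x)^-1.
Proof.
move=> Dx; apply: (mulgI (cfun phi x)).
by rewrite -cfunM ?mulgV ?cfun1 //; apply: sgV.
Qed.

Lemma cfun_inj x y : sg_set (dom phi) x -> sg_set (dom phi) y ->
  cfun phi x = cfun phi y -> x = y.
Proof.
move=> /domP[u <-] /domP[v <-]; rewrite !cfunE => /val_inj.
by move=> /(bij_inj (iso_bij phi)) ->.
Qed.

Lemma cfun_surj y : sg_set (cod phi) y -> exists2 x, sg_set (dom phi) x & cfun phi x = y.
Proof.
move=> /mem_set yC; have [g _ gK] := iso_bij phi.
exists (val (g (SgType yC))); first exact/set_mem/valP.
by rewrite cfunE gK.
Qed.

End Cfun.

Lemma comm_equivP (G : groupType) (phi psi : commensuration G) :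
  comm_equiv phi psi <->
  exists H : subgroup G, [/\ finite_index H, H `<=` sg_set (dom phi), H `<=` dom psi
    & forall x, sg_set H x -> cfun phi x = cfun psi x].
Proof.
split=> [[H finH e]|[H [finH Hphi Hpsi e]]].
  have [HI _] := finH; exists H; split=> [|||x Hx].
  - apply: (finite_index_trans (K := subgroupI (dom phi) (dom psi))) => //.
    by apply: finite_indexI; apply: dom_fi.
  - by move=> x /HI[].
  - by move=> x /HI[].
  have [/domP[u ux] /domP[v vx]] := HI _ Hx.
  by rewrite -{1}ux -vx !cfunE; apply: e; rewrite ux.
exists H; first by apply: finite_index_inT => // x Hx; split; auto.
by move=> x y xy Hx; rewrite -!cfunE -xy; apply: e.
Qed.

Lemma comm_equiv_refl (G : groupType) (phi : commensuration G) :
  comm_equiv phi phi.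
Proof. by apply/comm_equivP; exists (dom phi); split=> //; apply: dom_fi. Qed.

Lemma comm_equiv_sym (G : groupType) (phi psi : commensuration G) :
  comm_equiv phi psi -> comm_equiv psi phi.
Proof.
move=> /comm_equivP[H [finH Hphi Hpsi e]]; apply/comm_equivP.
by exists H; split=> // x /e.
Qed.

Lemma comm_equiv_trans (G : groupType) (chi phi psi : commensuration G) :
  comm_equiv phi chi -> comm_equiv chi psi -> comm_equiv phi psi.
Proof.
move=> /comm_equivP[H [finH Hphi Hchi e]] /comm_equivP[K [finK Kchi Kpsi f]].
apply/comm_equivP; exists (subgroupI H K); split.
- exact: finite_indexI.
- by move=> x [/Hphi].
- by move=> x [_ /Kpsi].
- by move=> x [Hx Kx]; rewrite e // f.
Qed.

Definition comm_equivb (G : groupType) : rel (commensuration G) :=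
  fun phi psi => `[< comm_equiv phi psi >].

Lemma comm_equivb_refl (G : groupType) : reflexive (@comm_equivb G).
Proof. by move=> phi; apply/asboolP/comm_equiv_refl. Qed.

Lemma comm_equivb_sym (G : groupType) : symmetric (@comm_equivb G).
Proof. by move=> phi psi; apply/asbool_equiv_eq; split=> /comm_equiv_sym. Qed.

Lemma comm_equivb_trans (G : groupType) : transitive (@comm_equivb G).
Proof.
by move=> ? ? ? /asboolP e /asboolP f; apply/asboolP/(comm_equiv_trans e).
Qed.

Canonical comm_equiv_rel (G : groupType) :=
  EquivRel (@comm_equivb G) (@comm_equivb_refl G) (@comm_equivb_sym G)
    (@comm_equivb_trans G).

Definition Comm (G : groupType) : Type := {eq_quot (@comm_equiv_rel G)}.

HB.instance Definition _ (G : groupType) := Choice.on (Comm G).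
HB.instance Definition _ (G : groupType) := Quotient.on (Comm G).

Lemma comm_piP (G : groupType) (phi psi : commensuration G) :
  \pi_(Comm G) phi = \pi_(Comm G) psi <-> comm_equiv phi psi.
Proof. by split=> [/eqmodP/asboolP|e]; last exact/eqmodP/asboolP. Qed.

(* The commensuration D -> C induced by f : G -> G. *)
Section MkComm.
Context (G : groupType) (D C : subgroup G).
Hypotheses (finD : finite_index D) (finC : finite_index C).
Variable f : G -> G.
Hypothesis fM : forall x y, sg_set D x -> sg_set D y -> f (x * y) = f x * f y.
Hypothesis f_inj : forall x y, sg_set D x -> sg_set D y -> f x = f y -> x = y.
Hypothesis f_im : f @` sg_set D = sg_set C.

Lemma mk_fun_subproof (u : sg_type D) : f (val u) \in sg_set C.
Proof.
by apply/mem_set; rewrite -f_im; exists (val u) => //; apply/set_mem/valP.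
Qed.

Definition mk_fun (u : sg_type D) : sg_type C := SgType (mk_fun_subproof u).

Lemma mk_funM : {morph mk_fun : u v / u * v}.
Proof.
by move=> u v; apply/val_inj; rewrite /= fM //; apply/set_mem/valP.
Qed.

HB.instance Definition _ :=
  isMultiplicative.Build (sg_type D) (sg_type C) mk_fun mk_funM.

Lemma mk_fun_bij : bijective mk_fun.
Proof.
have ex (v : sg_type C) : exists u, mk_fun u = v.
  have [x /mem_set xD fx] : (f @` sg_set D) (val v).
    by rewrite f_im; apply/set_mem/valP.
  by exists (SgType xD); apply/val_inj.
have inj : injective mk_fun.
  move=> u v /(congr1 val) /= /f_inj e; apply/val_inj/e; exact/set_mem/valP.
exists (fun v => sval (cid (ex v))) => u; last by case: cid.
by apply: inj; case: cid.
Qed.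

Definition mk_comm : commensuration G :=
  Commensuration finD finC (@GroupIso (sg_type D) (sg_type C) mk_fun mk_fun_bij).

Lemma mk_commE x : sg_set D x -> cfun mk_comm x = f x.
Proof. by move=> /mem_set xD; rewrite /cfun insubT. Qed.

End MkComm.

Definition comm_id (G : groupType) : commensuration G :=
  @mk_comm G (subgroupT G) (subgroupT G) (@finite_indexT G) (@finite_indexT G)
    id (fun _ _ _ _ => erefl) (fun _ _ _ _ e => e) (image_id _).

Lemma comm_idE (G : groupType) (x : G) : cfun (comm_id G) x = x.
Proof. exact: mk_commE. Qed.

Section Inverse.
Context (G : groupType) (phi : commensuration G).

Definition cinv_fun (y : G) : G :=
  xget 1 [set x | sg_set (dom phi) x /\ cfun phi x = y].

Lemma cinv_funP y : sg_set (cod phi) y ->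
  sg_set (dom phi) (cinv_fun y) /\ cfun phi (cinv_fun y) = y.
Proof.
by move=> /cfun_surj[x Dx xy]; rewrite /cinv_fun; case: xgetP => [? _ //|/(_ x)]; case.
Qed.

Lemma cinv_funK x : sg_set (dom phi) x -> cinv_fun (cfun phi x) = x.
Proof.
move=> Dx; have [D'x] := cinv_funP (cfun_cod Dx).
exact: cfun_inj.
Qed.

Lemma cinv_funM x y : sg_set (cod phi) x -> sg_set (cod phi) y ->
  cinv_fun (x * y) = cinv_fun x * cinv_fun y.
Proof.
move=> /cinv_funP[Dx xE] /cinv_funP[Dy yE]; rewrite -{1}xE -{1}yE.
by rewrite -cfunM // cinv_funK //; apply: sgM.
Qed.

Lemma cinv_fun_inj x y : sg_set (cod phi) x -> sg_set (cod phi) y ->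
  cinv_fun x = cinv_fun y -> x = y.
Proof.
by move=> /cinv_funP[_ xE] /cinv_funP[_ yE] xy; rewrite -xE -yE xy.
Qed.

Lemma cinv_fun_im : cinv_fun @` sg_set (cod phi) = sg_set (dom phi).
Proof.
apply/seteqP; split=> [_ [y /cinv_funP[Dy _] <-] //|x Dx].
by exists (cfun phi x); [apply: cfun_cod|apply: cinv_funK].
Qed.

Definition comm_inv : commensuration G :=
  mk_comm (cod_fi phi) (dom_fi phi) cinv_funM cinv_fun_inj cinv_fun_im.

Lemma comm_invE y : sg_set (cod phi) y -> cfun comm_inv y = cinv_fun y.
Proof. exact: mk_commE. Qed.

Lemma preim_subproof (K : subgroup G) :
  is_subgroup [set x | sg_set (dom phi) x /\ sg_set K (cfun phi x)].
Proof.
apply: is_subgroupP => [|x y [Dx Kx] [Dy Ky]].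
  by rewrite /= cfun1; split; apply: sg1.
split; first by apply: sgM => //; apply: sgV.
rewrite cfunM ?cfunV //; last exact: sgV.
by apply: sgM => //; apply: sgV.
Qed.

Definition preim (K : subgroup G) : subgroup G := Subgroup (preim_subproof K).

Lemma finite_index_preim (K : subgroup G) :
  finite_index K -> finite_index (preim K).
Proof.
move=> finK; apply: (finite_index_trans (K := dom phi)); last exact: dom_fi.
have [T [c [cfin csep]]] := (finite_index_sepP (@subsetT _ K)).1 finK.
apply/finite_index_sepP; first by move=> x [].
exists T, (c \o cfun phi); split.
  by apply: sub_finite_set cfin => _ [x _ <-]; exists (cfun phi x).
move=> x y Dx Dy /(csep _ _ I I) Kxy; split; first by apply: sgM => //; apply: sgV.
by rewrite cfunM ?cfunV //; apply: sgV.
Qed.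

End Inverse.

(* The composite "first phi, then psi", defined on phi^-1 (dom psi). *)
Section Composition.
Context (G : groupType) (phi psi : commensuration G).

Definition comp_dom : subgroup G := preim phi (dom psi).
Definition comp_cod : subgroup G := preim (comm_inv psi) (cod phi).
Definition comp_fun (x : G) : G := cfun psi (cfun phi x).

Lemma comp_dom_fi : finite_index comp_dom.
Proof. exact/finite_index_preim/dom_fi. Qed.

Lemma comp_cod_fi : finite_index comp_cod.
Proof. exact/finite_index_preim/cod_fi. Qed.

Lemma comp_funM x y : sg_set comp_dom x -> sg_set comp_dom y ->
  comp_fun (x * y) = comp_fun x * comp_fun y.
Proof. by move=> [Dx Kx] [Dy Ky]; rewrite /comp_fun !cfunM. Qed.

Lemma comp_fun_inj x y : sg_set comp_dom x -> sg_set comp_dom y ->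
  comp_fun x = comp_fun y -> x = y.
Proof.
by move=> [Dx Kx] [Dy Ky] /(cfun_inj Kx Ky); apply: cfun_inj.
Qed.

Lemma comp_fun_im : comp_fun @` sg_set comp_dom = sg_set comp_cod.
Proof.
apply/seteqP; split=> [_ [x [Dx Kx] <-]|z [Cz]].
  split; first exact: cfun_cod.
  by rewrite comm_invE ?cinv_funK //; exact: cfun_cod.
rewrite comm_invE //; have [Dz zE] := cinv_funP Cz.
move=> /cfun_surj[x Dx xE]; exists x; last by rewrite /comp_fun xE.
by split; rewrite // xE.
Qed.

Definition comm_comp : commensuration G :=
  mk_comm comp_dom_fi comp_cod_fi comp_funM comp_fun_inj comp_fun_im.

Lemma comm_compE x : sg_set comp_dom x ->
  cfun comm_comp x = cfun psi (cfun phi x).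
Proof. exact: mk_commE. Qed.

End Composition.

Lemma comm_comp_equiv (G : groupType) (phi phi' psi psi' : commensuration G) :
  comm_equiv phi phi' -> comm_equiv psi psi' ->
  comm_equiv (comm_comp phi psi) (comm_comp phi' psi').
Proof.
move=> /comm_equivP[H [finH HD HD' e]] /comm_equivP[K [finK KD KD' f]].
apply/comm_equivP; exists (subgroupI H (preim phi K)); split.
- by apply: finite_indexI => //; apply: finite_index_preim.
- by move=> x [Hx [Dx Kx]]; split=> //; apply: KD.
- by move=> x [Hx [Dx Kx]]; split; [exact: HD'|rewrite -e //; exact: KD'].
move=> x [Hx [Dx Kx]].
rewrite !comm_compE; first by rewrite -(e x Hx) f.
- by split; [exact: HD'|rewrite -e //; exact: KD'].
- by split=> //; apply: KD.
Qed.

Definition Comm_one (G : groupType) : Comm G := \pi_(Comm G) (comm_id G).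
Definition Comm_mul (G : groupType) (a b : Comm G) : Comm G :=
  \pi_(Comm G) (comm_comp (repr a) (repr b)).
Definition Comm_inv (G : groupType) (a : Comm G) : Comm G :=
  \pi_(Comm G) (comm_inv (repr a)).

Lemma Comm_mul_pi (G : groupType) (phi psi : commensuration G) :
  Comm_mul (\pi_(Comm G) phi) (\pi_(Comm G) psi) =
  \pi_(Comm G) (comm_comp phi psi).
Proof.
by apply/comm_piP/comm_comp_equiv; apply/comm_piP; rewrite reprK.
Qed.

Lemma Comm_mulA (G : groupType) : associative (@Comm_mul G).
Proof.
elim/quotW=> p; elim/quotW=> q; elim/quotW=> r.
rewrite (Comm_mul_pi q r) (Comm_mul_pi p q) (Comm_mul_pi p (comm_comp q r)).
rewrite (Comm_mul_pi (comm_comp p q) r).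
apply/comm_piP/comm_equivP.
exists (comp_dom p (comm_comp q r)).
have sub x : sg_set (comp_dom p (comm_comp q r)) x ->
    sg_set (comp_dom (comm_comp p q) r) x.
  move=> [Dx [Dpx Dqpx]]; have Dpq : sg_set (comp_dom p q) x by [].
  by split=> //; rewrite comm_compE.
split=> [|x h|x /sub h|x Hx]; [exact: comp_dom_fi|exact: h|exact: h|].
have [Dx [Dpx Dqpx]] := Hx.
by rewrite (comm_compE Hx) comm_compE // comm_compE ?comm_compE //; apply: sub.
Qed.

Lemma Comm_mul1 (G : groupType) : left_id (@Comm_one G) (@Comm_mul G).
Proof.
elim/quotW=> p; rewrite Comm_mul_pi; apply/comm_piP/comm_equivP.
have sub x : sg_set (dom p) x -> sg_set (comp_dom (comm_id G) p) x.
  by move=> Dx; split=> //; rewrite comm_idE.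
exists (dom p); split=> [|x /sub h|x h|x Dx]; [exact: dom_fi|exact: h|exact: h|].
by rewrite comm_compE ?comm_idE //; apply: sub.
Qed.

Lemma Comm_mulr1 (G : groupType) : right_id (@Comm_one G) (@Comm_mul G).
Proof.
elim/quotW=> p; rewrite Comm_mul_pi; apply/comm_piP/comm_equivP.
exists (dom p); split=> [|x Dx|x h|x Dx]; [exact: dom_fi|by []|exact: h|].
by rewrite comm_compE ?comm_idE.
Qed.

Lemma Comm_mulV (G : groupType) :
  left_inverse (@Comm_one G) (@Comm_inv G) (@Comm_mul G).
Proof.
move=> a; rewrite -[X in Comm_mul _ X]reprK Comm_mul_pi.
apply/comm_piP/comm_equivP; set p := repr a.
have sub x : sg_set (cod p) x -> sg_set (comp_dom (comm_inv p) p) x.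
  by move=> Cx; split=> //; rewrite comm_invE //; have [] := cinv_funP Cx.
exists (cod p); split=> [|x /sub h|x h|x Cx]; [exact: cod_fi|exact: h|by []|].
rewrite comm_idE comm_compE ?comm_invE //; last exact: sub.
by have [] := cinv_funP Cx.
Qed.

Lemma Comm_mulrV (G : groupType) :
  right_inverse (@Comm_one G) (@Comm_inv G) (@Comm_mul G).
Proof.
move=> a; rewrite -[X in Comm_mul X _]reprK Comm_mul_pi.
apply/comm_piP/comm_equivP; set p := repr a.
have sub x : sg_set (dom p) x -> sg_set (comp_dom p (comm_inv p)) x.
  by move=> Dx; split=> //; apply: cfun_cod.
exists (dom p); split=> [|x /sub h|x h|x Dx]; [exact: dom_fi|exact: h|by []|].
rewrite comm_idE comm_compE ?comm_invE ?cinv_funK //; [exact: cfun_cod|exact: sub].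
Qed.

HB.instance Definition _ (G : groupType) :=
  isGroup.Build (Comm G) (@Comm_mulA G) (@Comm_mul1 G) (@Comm_mulr1 G)
    (@Comm_mulV G) (@Comm_mulrV G).

(* Elements of Comm G act on the right: phi * psi is first phi, then psi. *)
Lemma Comm_mulE (G : groupType) (phi psi : commensuration G) :
  \pi_(Comm G) phi * \pi_(Comm G) psi = \pi_(Comm G) (comm_comp phi psi).
Proof. exact: Comm_mul_pi. Qed.

Lemma bij_inv_ex (T U : Type) (f : T -> U) :
  bijective f -> exists g, cancel f g /\ cancel g f.
Proof. by case=> g fK gK; exists g. Qed.

Definition bij_inv (T U : Type) (f : T -> U) (fb : bijective f) : U -> T :=
  sval (cid (bij_inv_ex fb)).

Lemma bij_invK (T U : Type) (f : T -> U) (fb : bijective f) :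
  cancel f (bij_inv fb).
Proof. by rewrite /bij_inv; case: cid => ? []. Qed.

Lemma bij_invKV (T U : Type) (f : T -> U) (fb : bijective f) :
  cancel (bij_inv fb) f.
Proof. by rewrite /bij_inv; case: cid => ? []. Qed.

(* The composite LO(G) -> LO(G1) -> LO(G2) -> LO(G) attached to phi : G1 -> G2. *)
Definition comm_act (G : groupType)
    (res_bij : forall H : subgroup G, finite_index H -> bijective (@LO_res G H))
    (phi : commensuration G) : LO G -> LO G :=
  bij_inv (res_bij (cod phi) (cod_fi phi)) \o LO_map phi \o @LO_res G (dom phi).

Definition is_right_action (A : groupType) (X : Type) (act : X -> A -> X)
    : Prop :=
  (forall x, act x 1 = x) /\ (forall x a b, act x (a * b) = act (act x a) b).

(* Main.v *)
Require Import Defs.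
From HB Require Import structures.
From mathcomp Require Import all_boot.
From mathcomp Require Import boolp classical_sets functions cardinality.

Set Implicit Arguments.
Unset Strict Implicit.
Unset Printing Implicit Defensive.

Local Open Scope classical_set_scope.
Local Open Scope quotient_scope.
Local Open Scope group_scope.

(** In a left-ordered group an element has the sign of each of its positive
powers, and every element of G has a positive power in the finite-index
subgroup H. Hence an order on G is determined by its restriction to H
([LO_eq_finite_index]), and an order p on H leaves one candidate for an
extension: g is positive when some g^n with n > 0 is positive in H. That
exactly one of g, g^-1 is positive when g <> 1 uses that G is torsion-free.
What remains is that a product of two positive elements is positive
([radical_posM]).

Let S be the monoid of nonnegative elements of H, and call radical S the set of
elements with a positive power in S; for every g, one of g, g^-1 lies in it.
Suppose that x and y are positive and xy is not. Everything now happens in the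
nilpotent group N generated by x and y. In the abelianization of N the classes
of x, y and (xy)^-1 generate the whole group as a monoid, so that every element
of N has a power in S modulo the commutator subgroup. This property then
descends along the lower central series, until every element of N lies in
radical S ([radical_nilpotent]). This is absurd for x^-1, since x is positive.

One step of the descent takes place in the quotient by a term of the lower
central series, where the previous term becomes a central subgroup Z generated
by finitely many commutators ([lcs_generators]). By assumption some powers of
u, h, u^-1 and h^-1 lie in S up to factors in Z. Multiplying the N-th powers of
these in the order of a commutator word produces a power of [u, h] whose
exponent is quadratic in N, while the factors from Z contribute e^N only. Hence
[u, h]^(pN) e lies in radical S for all N, with p > 0 and e in Z independent of
N ([commutator_growth]). On Z there is a total preorder, in which b is above a
when b a^-1 lies in radical S. Let w be a commutator above all the chosen
generators and their inverses ([dominant_ex]); then some power of w is above e.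
Since w^-1 is a commutator too, letting N grow shows that w^-1 lies in
radical S. So w is both above and below 1, and therefore so is every generator:
Z is contained in radical S ([radical_central_extension]).

For the action of the commensurator, the order obtained from o by phi is the
only one for which phi preserves order on some finite-index subgroup
([comm_act_unique]). This description does not see the difference between
equivalent commensurations, and it is compatible with composition. *)

(** * Generated subgroups *)

Lemma generated_is_subgroup (G : groupType) (A : set G) :
  is_subgroup (generated A).
Proof.
apply: is_subgroupP => [H [sH _]|x y xA yA H [sH AH]].
  exact: (sg1 (Subgroup sH)).
have Hx := xA H (conj sH AH); have Hy := yA H (conj sH AH).
by apply: (@sgM _ (Subgroup sH)) => //; apply: (@sgV _ (Subgroup sH)).
Qed.

Definition generated_subgroup (G : groupType) (A : set G) : subgroup G :=
  Subgroup (@generated_is_subgroup G A).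

Lemma mem_generated (G : groupType) (A : set G) x : A x -> generated A x.
Proof. exact: sub_gen_smallest. Qed.

Lemma sub_generated (G : groupType) (A : set G) (H : subgroup G) :
  A `<=` H -> generated A `<=` H.
Proof. by move=> AH; apply: smallest_sub => //; apply: sg_closed. Qed.

Lemma image_generated (G H : groupType) (f : UMagmaMorphism.type G H)
    (A : set G) (B : set H) :
  f @` A `<=` generated B -> f @` generated A `<=` generated B.
Proof.
move=> AB _ [x Ax <-].
have pre : is_subgroup [set x | generated B (f x)].
  apply: is_subgroupP => [|u v Bu Bv].
    by rewrite /= gmulf1; apply: (sg1 (generated_subgroup B)).
  rewrite /= gmulfF; apply: (@sgM _ (generated_subgroup B)) => //.
  exact: (@sgV _ (generated_subgroup B)).
suff /(_ x Ax) : generated A `<=` Subgroup pre by [].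
by apply: sub_generated => a Aa; apply: AB; exists a.
Qed.

(** * Submonoids, radicals and central elements *)

Definition submonoid (G : groupType) (S : set G) : Prop :=
  S 1 /\ forall x y, S x -> S y -> S (x * y).

(** The exponent is positive: if S contains 1, the power g^0 would make every
element a member. *)
Definition radical (G : groupType) (S : set G) : set G :=
  [set g | exists n, S (g ^+ n.+1)].

Definition central (G : groupType) (z : G) : Prop := forall g, commute z g.

Section Central.
Context (G : groupType).
Implicit Types x y z : G.

Lemma central1 : central (1 : G).
Proof. by move=> g; apply/commute_sym/commute1. Qed.

Lemma centralM x y : central x -> central y -> central (x * y).
Proof. by move=> xC yC g; apply/commute_sym/commuteM; apply/commute_sym. Qed.

Lemma centralV x : central x -> central x^-1.
Proof. by move=> xC g; apply/commute_sym/commuteV/commute_sym. Qed.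

Lemma centralX x n : central x -> central (x ^+ n).
Proof. by move=> xC g; apply/commute_sym/commuteX/commute_sym. Qed.

Lemma mulg_central z a b y : central z -> a * z * (b * y) = a * b * (z * y).
Proof. by move=> zC; rewrite -!mulgA; congr (_ * _); rewrite !mulgA zC. Qed.

(** Commutation up to a central factor w is bilinear: moving each of the m
copies of y across each of the n copies of x costs one w. *)
Lemma central_commXX x y w n m : central w -> x * y = y * x * w ->
  x ^+ n * y ^+ m = y ^+ m * x ^+ n * w ^+ (n * m).
Proof.
move=> wC xy.
have xny : x ^+ n * y = y * x ^+ n * w ^+ n.
  elim: n => [|n IHn]; first by rewrite !expg0 !mulg1 mul1g.
  rewrite expgS -mulgA IHn !mulgA xy -[y * x * w * _]mulgA.
  by rewrite (wC (x ^+ n)) !expgS !mulgA.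
elim: m => [|m IHm]; first by rewrite muln0 !expg0 !mulg1 mul1g.
rewrite [y ^+ m.+1]expgSr mulgA IHm -mulgA (centralX _ wC) mulgA -[_ * y]mulgA.
by rewrite xny mulnS expgnDr !mulgA.
Qed.

Lemma central_commgXX x y n m : central [~ x, y] ->
  [~ x ^+ n, y ^+ m] = [~ x, y] ^+ (n * m).
Proof.
move=> wC; have := central_commXX n m wC (commgC x y).
by rewrite [X in X = _]commgC => /mulgI.
Qed.

End Central.

(** * Monoids that contain a power of every element up to a central subgroup *)

Section Radical.
Context (G : groupType) (S : set G).
Hypothesis SM : submonoid S.
Let S1 : S 1 := SM.1.
Let Smul := SM.2.

Lemma submonoidX g n : S g -> S (g ^+ n).
Proof. by move=> Sg; elim: n => [//|n IHn]; rewrite expgS; apply: Smul. Qed.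

Lemma radical_id g : S g -> radical S g.
Proof. by move=> Sg; exists 0. Qed.

Lemma radicalM g h : commute g h -> radical S g -> radical S h ->
  radical S (g * h).
Proof.
move=> gh [n Sg] [m Sh]; exists (n.+1 * m.+1).-1.
rewrite prednK // expgMn //; apply: Smul; rewrite ?[g ^+ _]expgnA.
  exact: submonoidX.
by rewrite mulnC expgnA; apply: submonoidX.
Qed.

Lemma radical_root g n : radical S (g ^+ n.+1) -> radical S g.
Proof.
by move=> [m Sg]; exists (n.+1 * m.+1).-1; rewrite prednK // expgnA.
Qed.

(** Two commuting elements of the radical have their product in it, so the
central elements that lie in the radical together with their inverses form a
group. *)
Lemma radical_generated (W : set G) :
  (forall v, W v -> [/\ central v, radical S v & radical S v^-1]) ->
  forall z, generated W z -> radical S z.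
Proof.
move=> WP z Wz.
pose B : set G := [set z | [/\ central z, radical S z & radical S z^-1]].
suff /(_ z Wz)[] : generated W `<=` B by [].
apply: smallest_sub => //; apply: is_subgroupP.
  by split; rewrite ?invg1; [apply: central1|apply: radical_id..].
move=> x y [xC xS xVS] [yC yS yVS]; split.
- by apply: centralM => //; apply: centralV.
- exact: radicalM.
- by rewrite invgF; apply: radicalM.
Qed.

Hypothesis tot : forall g, radical S g \/ radical S g^-1.

(** The element w is a maximum of the elements of W, their inverses and 1, for
the total preorder in which b is above a when b a^-1 lies in the radical. So w
need not be in W; the set C records what is to be known of it. *)
Lemma dominant_ex (C : set G) (W : seq G) :
  C 1 -> (forall x, C x -> C x^-1) -> (forall x, C x -> central x) ->
  (forall v, v \in W -> C v) ->
  exists w, [/\ C w, radical S w &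
    forall v, v \in W -> radical S (w * v) /\ radical S (w * v^-1)].
Proof.
move=> C1 CV Cc; elim: W => [|v W IHW] WC.
  by exists 1; split=> //; apply: radical_id.
have [|w [wC wS wW]] := IHW; first by move=> x xW; apply/WC/mem_behead.
have [v' [v'C v'S vv']] :
    exists v', [/\ C v', radical S v' & v = v' \/ v = v'^-1].
  have vC : C v by apply: WC; rewrite mem_head.
  have [vS|vS] := tot v; first by exists v; split=> //; left.
  by exists v^-1; split; [apply: CV|by []|right; rewrite invgK].
suff [u [uC uS uv' uW]] : exists u, [/\ C u, radical S u,
    radical S (u * v') /\ radical S (u * v'^-1) &
    forall x, x \in W -> radical S (u * x) /\ radical S (u * x^-1)].
  exists u; split=> // x; rewrite inE => /predU1P[->|/uW //].
  by case: vv' => ->; rewrite ?invgK; case: uv'.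
(* The maximum so far is compared with the nonnegative one of v and v^-1. *)
have [wv'|] := tot (w / v').
  by exists w; split=> //; split=> //; apply: radicalM => //; apply: Cc.
rewrite invgF => v'w; exists v'; split=> // [|x /wW[wx wxV]].
  split; first by apply: radicalM.
  by rewrite mulgV; apply: radical_id.
by split; rewrite -[v'](mulgVK w) -mulgA; apply: radicalM => //;
  apply: centralM; rewrite //; apply: Cc => //; apply: CV.
Qed.

Context (Z : subgroup G).
Hypothesis Zc : forall z, sg_set Z z -> central z.
Hypothesis SZ : forall g, exists n z, sg_set Z z /\ S (g ^+ n.+1 * z).

Lemma sgX (z : G) n : sg_set Z z -> sg_set Z (z ^+ n).
Proof.
move=> Zz; elim: n => [|n IHn]; first exact: sg1.
by rewrite expgS; apply: sgM.
Qed.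

(** The element u^n y of S need not have its inverse in S, but the inverse has a
power in S up to Z; a further power makes the two exponents of u opposite. *)
Lemma power_and_inverse u : exists n y z, [/\ sg_set Z y, sg_set Z z,
  S (u ^+ n.+1 * y) & S (u^-1 ^+ n.+1 * z)].
Proof.
have [a [y [Zy Sy]]] := SZ u.
have [b [z [Zz Sz]]] := SZ (u ^+ a.+1 * y)^-1.
exists (a.+1 * b.+1).-1, (y ^+ b.+1), (y^-1 ^+ b.+1 * z); rewrite prednK //.
have cy : commute (u ^+ a.+1) y by apply/commute_sym/Zc.
split.
- exact: sgX.
- by apply: sgM => //; apply/sgX/sgV.
- by rewrite expgnA -expgMn //; apply: submonoidX.
- rewrite mulgA expgnA -expgMn; last exact/commute_sym/centralV/Zc.
  by rewrite expVgn -(centralV (Zc Zy)) -invgM.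
Qed.

(** The product of the N.+1-st powers of elements of S of the form u^-n z,
h^-m z', u^n y and h^m y' equals [u, h] to the n m (N.+1)^2 times the N.+1-st
power of e = z z' y y'. The exponent of the commutator has one factor N.+1
more than that of e, and it survives when an N.+1-st root is taken. *)
Lemma commutator_growth u h : central [~ u, h] -> exists p e, sg_set Z e /\
  forall N, radical S ([~ u, h] ^+ (p.+1 * N.+1) * e).
Proof.
move=> wC.
have [n [y [z [Zy Zz Sy Sz]]]] := power_and_inverse u.
have [m [y' [z' [Zy' Zz' Sy' Sz']]]] := power_and_inverse h.
exists (n.+1 * m.+1).-1, (z * (z' * (y * y'))); split; first by do !apply: sgM.
move=> N; exists N; rewrite prednK //.
have zC := Zc Zz; have z'C := Zc Zz'; have yC := Zc Zy; have y'C := Zc Zy'.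
have expM x t k : central t -> S (x ^+ k.+1 * t) ->
    S (x ^+ (k.+1 * N.+1) * t ^+ N.+1).
  move=> tC /(submonoidX N.+1); rewrite expgMn; last exact/commute_sym.
  by rewrite -expgnA.
have := Smul (expM _ _ _ zC Sz) (Smul (expM _ _ _ z'C Sz')
  (Smul (expM _ _ _ yC Sy) (expM _ _ _ y'C Sy'))).
rewrite (mulg_central _ _ _ (centralX N.+1 yC)).
rewrite (mulg_central _ _ _ (centralX N.+1 z'C)).
rewrite (mulg_central _ _ _ (centralX N.+1 zC)).
rewrite expgMn; last by apply/commute_sym; do !apply: centralM.
rewrite (expgMn N.+1 (zC _)) (expgMn N.+1 (z'C _)) (expgMn N.+1 (yC _)).
rewrite !expVgn -expgnA.
suff -> : u ^- (n.+1 * N.+1) * (h ^- (m.+1 * N.+1) *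
    (u ^+ (n.+1 * N.+1) * h ^+ (m.+1 * N.+1))) =
  [~ u, h] ^+ (n.+1 * m.+1 * N.+1 * N.+1) by [].
rewrite -conjgE -commgEl central_commgXX //; congr (_ ^+ _).
by rewrite mulnACA !mulnA.
Qed.

(** A commutator w = [u, h] that dominates W has a power w^k above any given e
in Z. The growth of the commutator w^-1 = [h, u] gives an e in Z such that e is
above w^(pN) for all N. For large N both are possible only if w is below 1, and
then so are all generators of Z and their inverses. *)
Lemma radical_central_extension (W : seq G) :
  (forall v, v \in W -> sg_set Z v /\ exists u h, v = [~ u, h]) ->
  sg_set Z `<=` generated [set` W] ->
  forall g, radical S g.
Proof.
move=> WP ZW.
(* Once Z lies in the radical, the central factors can be removed. *)
suff Zrad z : sg_set Z z -> radical S z.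
  move=> g; have [n [z [Zz Sz]]] := SZ g.
  apply: (@radical_root g n); rewrite -[g ^+ _](mulgK z).
  apply: radicalM; first exact/commute_sym/centralV/Zc.
    exact: radical_id.
  exact/Zrad/sgV.
pose C : set G := [set v | central v /\ exists u h, v = [~ u, h]].
have [|||v /WP[Zv]|w [[wC [u [h wE]]] wS wW]] := @dominant_ex C W.
- by split; [apply: central1|exists 1, 1; rewrite commg1].
- move=> x [xC [u [h xE]]]; split; first exact: centralV.
  by exists h, u; rewrite xE invgR.
- by move=> x [].
- by split=> //; apply: Zc.
have wVC := centralV wC.
have Zdom e : sg_set Z e -> exists k, radical S (w ^+ k * e^-1).
  pose B : set G := [set z | central z /\ exists k l,
    radical S (w ^+ k * z) /\ radical S (w ^+ l * z^-1)].
  move=> /ZW We.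
  suff /(_ e We)[_ [_ [l [_ we]]]] : generated [set` W] `<=` B by exists l.
  apply: smallest_sub => [|v /= vW]; last first.
    have [Zv _] := WP v vW; split; first exact: Zc.
    by exists 1%N, 1%N; rewrite expg1; apply: wW.
  apply: is_subgroupP => [|x y [xC [k [l [xk xl]]]] [yC [k' [l' [yk yl]]]]].
    split; first exact: central1.
    by exists 0, 0; rewrite expg0 invg1 mulg1; split; apply: radical_id.
  split; first by apply: centralM => //; apply: centralV.
  exists (k + l')%N, (l + k')%N; rewrite invgM invgK !expgnDr; split.
    rewrite -mulg_central //; apply: radicalM => //.
    by apply: centralM => //; apply: centralX.
  rewrite (yC x^-1) -mulg_central; last exact: centralV.
  apply: radicalM => //.
  by apply: centralM; [apply: centralX|apply: centralV].
have wVS : radical S w^-1.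
  have wVE : w^-1 = [~ h, u] by rewrite wE invgR.
  have [|p [e [Ze eS]]] := @commutator_growth h u; first by rewrite -wVE.
  (* With N = k the negative exponent p.+1 * k.+1 of w exceeds k. *)
  have [k ke] := Zdom e Ze.
  apply: (@radical_root _ (p.+1 * k.+1 - k.+1)).
  have cC : central (w ^+ k / e).
    by apply: centralM; [apply: centralX|apply/centralV/Zc].
  have := radicalM (cC _) ke (eS k); rewrite -wVE mulg_central; last first.
    exact/centralV/Zc.
  have lekp : k < p.+1 * k.+1 by rewrite leq_pmull.
  by rewrite mulVg mulg1 -subSn // subSS !expVgn expgnFr 1?ltnW // invgF.
move=> /ZW; apply: radical_generated => v /= vW.
have [Zv _] := WP v vW; have [wv wvV] := wW v vW.
have wK x : radical S (w * x) -> radical S x.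
  by move=> wx; rewrite -[x](mulKg w); apply: radicalM.
by split; [apply: Zc|apply: wK..].
Qed.

End Radical.

(** * Quotients by normal subgroups *)

Section Quotient.
Context (G : groupType) (K : subgroup G).
Hypothesis nK : forall k g, sg_set K k -> sg_set K (k ^ g).

Definition coset_rel : rel G := fun x y => `[< sg_set K (x^-1 * y) >].

Lemma coset_rel_refl : reflexive coset_rel.
Proof. by move=> x; apply/asboolP; rewrite mulVg; apply: sg1. Qed.

Lemma coset_rel_sym : symmetric coset_rel.
Proof.
by move=> x y; apply/asbool_equiv_eq; split=> /sgV; rewrite invgM invgK.
Qed.

Lemma coset_rel_trans : transitive coset_rel.
Proof.
move=> y x z /asboolP xy /asboolP yz; apply/asboolP.
by rewrite -[z](mulVKg y) mulgA; apply: sgM.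
Qed.

Canonical coset_equiv :=
  EquivRel coset_rel coset_rel_refl coset_rel_sym coset_rel_trans.

(** Normality is an argument of the type, so that the group structure, which
depends on it, can be found from the type alone. *)
Definition quotient_of (_ : forall k g, sg_set K k -> sg_set K (k ^ g)) :
    Type := {eq_quot coset_equiv}.
Local Notation Q := (quotient_of nK).

HB.instance Definition _ := Choice.on Q.
HB.instance Definition _ := Quotient.on Q.

Definition quo (x : G) : Q := \pi_Q x.

Lemma quoP x y : quo x = quo y <-> sg_set K (x^-1 * y).
Proof. by split=> [/eqmodP/asboolP|xy]; last exact/eqmodP/asboolP. Qed.

Lemma quo_surj (q : Q) : exists x, quo x = q.
Proof. by exists (repr q); apply: reprK. Qed.

Definition quo_mul (a b : Q) : Q := quo (repr a * repr b).
Definition quo_inv (a : Q) : Q := quo (repr a)^-1.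

Lemma quo_mulE x y : quo_mul (quo x) (quo y) = quo (x * y).
Proof.
have /quoP xx : quo (repr (quo x)) = quo x by apply: reprK.
have /quoP yy : quo (repr (quo y)) = quo y by apply: reprK.
apply/quoP; set x' := repr _ in xx *; set y' := repr _ in yy *.
have -> : (x' * y')^-1 * (x * y) = (x'^-1 * x) ^ y' * (y'^-1 * y).
  by rewrite conjgE invgM !mulgA mulgK.
by apply: sgM; rewrite //; apply: nK.
Qed.

Lemma quo_invE x : quo_inv (quo x) = quo x^-1.
Proof.
have /quoP xx : quo (repr (quo x)) = quo x by apply: reprK.
apply/quoP; rewrite invgK; set x' := repr _ in xx *.
have -> : x' / x = ((x'^-1 * x)^-1) ^ x'^-1.
  by rewrite conjgE !invgM !invgK !mulgA mulgK.
exact/nK/sgV.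
Qed.

Lemma quo_mulA : associative quo_mul.
Proof.
move=> a b c; have [x <-] := quo_surj a; have [y <-] := quo_surj b.
by have [z <-] := quo_surj c; rewrite !quo_mulE mulgA.
Qed.

Lemma quo_mul1 : left_id (quo 1) quo_mul.
Proof. by move=> a; have [x <-] := quo_surj a; rewrite quo_mulE mul1g. Qed.

Lemma quo_mulr1 : right_id (quo 1) quo_mul.
Proof. by move=> a; have [x <-] := quo_surj a; rewrite quo_mulE mulg1. Qed.

Lemma quo_mulV : left_inverse (quo 1) quo_inv quo_mul.
Proof.
by move=> a; have [x <-] := quo_surj a; rewrite quo_invE quo_mulE mulVg.
Qed.

Lemma quo_mulrV : right_inverse (quo 1) quo_inv quo_mul.
Proof.
by move=> a; have [x <-] := quo_surj a; rewrite quo_invE quo_mulE mulgV.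
Qed.

HB.instance Definition _ :=
  isGroup.Build Q quo_mulA quo_mul1 quo_mulr1 quo_mulV quo_mulrV.

Lemma quoM : {morph quo : x y / x * y}.
Proof. by move=> x y; rewrite -quo_mulE. Qed.

Lemma quo_monoid_morphism : monoid_morphism quo.
Proof. by split; [|apply: quoM]. Qed.

HB.instance Definition _ := isUMagmaMorphism.Build G Q quo quo_monoid_morphism.

Lemma quo_central z : (forall g, sg_set K [~ z, g]) -> central (quo z).
Proof.
move=> zg q; have [g <-] := quo_surj q; rewrite /commute -!quoM.
apply/esym/quoP; suff -> : (g * z)^-1 * (z * g) = [~ z, g] by apply: zg.
by rewrite invgM -mulgA.
Qed.

End Quotient.

(** * The lower central series *)

Section LowerCentral.
Context (G : groupType).
Local Notation gamma := (lower_central [set: G]).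

Lemma lower_central_is_subgroup n : is_subgroup (gamma n).
Proof.
by case: n => [|n]; [apply: is_subgroupP|apply: generated_is_subgroup].
Qed.

Definition lcs n : subgroup G := Subgroup (lower_central_is_subgroup n).

Lemma lcs_comm n a g : gamma n a -> gamma n.+1 [~ a, g].
Proof. by move=> na; apply: mem_generated; exists a => //; exists g. Qed.

Lemma lcs_sub n : gamma n.+1 `<=` gamma n.
Proof.
elim: n => [//|n IHn]; apply: (@sub_generated _ _ (lcs n.+1)).
by move=> _ [a /IHn an [g _ <-]]; apply: lcs_comm.
Qed.

Lemma lcs_normal n a g : sg_set (lcs n) a -> sg_set (lcs n) (a ^ g).
Proof.
move=> an; rewrite -[a ^ g](mulVKg a) -commgEl.
apply: sgM => //; exact: (lcs_sub (lcs_comm g an)).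
Qed.

(** Modulo gamma n.+2, the commutator [u, h] with u in gamma n is bilinear in u
and h, so it is a product of commutators of generators and their inverses. The
bilinearity is used in this form: if R is a normal subgroup, the elements u
with [u, h] in R for all h in a given set form a group. *)
Lemma lcs_generators_step n (A L : seq G) : (forall g, generated [set` A] g) ->
  (forall v, v \in L -> gamma n v) ->
  gamma n `<=` generated ([set` L] `|` gamma n.+1) ->
  gamma n.+1 `<=`
    generated ([set` [seq [~ a, b] | a <- L, b <- A]] `|` gamma n.+2).
Proof.
move=> genA Ln genL; set L' := [seq _ | _ <- _, _ <- _].
set R := generated_subgroup ([set` L'] `|` gamma n.+2).
have R2 x : gamma n.+2 x -> sg_set R x by move=> x2; apply: mem_generated; right.
have Rsub : R `<=` lcs n.+1.
  apply: sub_generated => v [/allpairsP[[a b] [/= aL bA ->]]|/lcs_sub//].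
  by apply: lcs_comm; apply: Ln.
have RJ x g : sg_set R x -> sg_set R (x ^ g).
  move=> Rx; rewrite -[x ^ g](mulVKg x) -commgEl; apply: sgM => //.
  by apply: R2; apply: lcs_comm; apply: Rsub.
have RC u h : sg_set R [~ u, h] -> sg_set R [~ h, u].
  by move=> /sgV; rewrite invgR.
have RF u v h : sg_set R [~ u, h] -> sg_set R [~ v, h] -> sg_set R [~ u / v, h].
  move=> Ru Rv.
  have -> : [~ u / v, h] = ([~ u, h] / [~ v, h]) ^ v^-1.
    by rewrite !commgEl !conjgE !invgM !invgK !mulgA !(mulgK, mulgVK).
  by apply: RJ; apply: sgM => //; apply: sgV.
have stab (B : set G) :
    is_subgroup [set u | forall h, B h -> sg_set R [~ u, h]].
  apply: is_subgroupP => [h _|x y xB yB h Bh].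
    by rewrite comm1g; apply: sg1.
  by apply: RF; [apply: xB|apply: yB].
apply: (@sub_generated _ _ R) => _ [u /genL Lu [h _ <-]].
suff /(_ u Lu h I) : generated ([set` L] `|` gamma n.+1) `<=`
  Subgroup (stab setT) by [].
apply: sub_generated => {u Lu h} a [/= aL h _|a1 h _]; last first.
  by apply: (R2 _); apply: lcs_comm.
(* The roles of the two arguments are exchanged, to let h run over a group. *)
apply: (RC h a); suff /(_ h (genA h) a erefl) : generated [set` A] `<=`
  Subgroup (stab [set a]) by [].
apply: sub_generated => b /= bA _ ->; apply: (RC _ _); apply: mem_generated; left.
by apply/allpairsP; exists (a, b).
Qed.

(** That the generators are commutators is what makes [commutator_growth]
applicable to them. *)
Lemma lcs_generators (A : seq G) : (forall g, generated [set` A] g) ->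
  forall n, exists L : seq G,
    (forall v, v \in L -> gamma n.+1 v /\ exists u h, v = [~ u, h]) /\
    gamma n.+1 `<=` generated ([set` L] `|` gamma n.+2).
Proof.
move=> genA.
have step n (L : seq G) : (forall v, v \in L -> gamma n v) ->
    gamma n `<=` generated ([set` L] `|` gamma n.+1) ->
    exists L' : seq G,
    (forall v, v \in L' -> gamma n.+1 v /\ exists u h, v = [~ u, h]) /\
    gamma n.+1 `<=` generated ([set` L'] `|` gamma n.+2).
  move=> Ln genL; exists [seq [~ a, b] | a <- L, b <- A]; split.
    move=> _ /allpairsP[[a b] [/= aL bA ->]]; split; last by exists a, b.
    by apply: lcs_comm; apply: Ln.
  exact: lcs_generators_step.
elim=> [|n [L [LP genL]]]; last by apply: (step n.+1 L) => // v /LP[].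
apply: (step 0 A) => // g _.
suff /(_ g (genA g)) : generated [set` A] `<=`
  generated_subgroup ([set` A] `|` gamma 1) by [].
by apply: sub_generated => x xA; apply: mem_generated; left.
Qed.

End LowerCentral.

Lemma lower_central_morph (G H : groupType) (f : UMagmaMorphism.type G H)
    (K : set H) n : (forall x, K (f x)) ->
  f @` lower_central [set: G] n `<=` lower_central K n.
Proof.
move=> fK; elim: n => [|n IHn]; first by move=> _ [x _ <-].
apply: image_generated => _ [_ [a an [g _ <-]] <-].
apply: mem_generated; exists (f a); first by apply: IHn; exists a.
by exists (f g) => //; rewrite gmulfR.
Qed.

(** * Monoids in nilpotent groups *)

Section Image.
Context (G H : groupType) (f : UMagmaMorphism.type G H) (S : set G).

Lemma submonoid_image : submonoid S -> submonoid (f @` S).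
Proof.
move=> [S1 SM]; split; first by exists 1; rewrite ?gmulf1.
by move=> _ _ [x Sx <-] [y Sy <-]; exists (x * y); [apply: SM|apply: gmulfM].
Qed.

Lemma radical_image x : radical S x -> radical (f @` S) (f x).
Proof. by move=> [n Sx]; exists n; rewrite -gmulfXn; exists (x ^+ n.+1). Qed.

End Image.

Definition full_modulo (G : groupType) (S K : set G) : Prop :=
  forall g, exists n z, K z /\ S (g ^+ n.+1 * z).

Local Notation quo_lcs n := (@quo _ (lcs _ n) (@lcs_normal _ n)).

Section Nilpotent.
Context (G : groupType) (S : set G) (A : seq G).
Hypothesis SM : submonoid S.
Hypothesis tot : forall g, radical S g \/ radical S g^-1.
Hypothesis genA : forall g, generated [set` A] g.
Local Notation gamma := (lower_central [set: G]).

Lemma full_modulo_quo n :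
  full_modulo S (gamma n) <-> forall q, radical (quo_lcs n @` S) q.
Proof.
split=> [full q|full g].
  have [g <-] := quo_surj q.
  have [m [z [zn Sz]]] := full g; exists m; rewrite -gmulfXn.
  by exists (g ^+ m.+1 * z) => //; apply/esym/quoP; rewrite mulKg.
have [m [s Ss]] := full (quo_lcs n g); rewrite -gmulfXn => /esym/quoP gs.
by exists m, ((g ^+ m.+1)^-1 * s); rewrite mulVKg.
Qed.

Lemma radical_quo_total n q :
  radical (quo_lcs n @` S) q \/ radical (quo_lcs n @` S) q^-1.
Proof.
have [g <-] := quo_surj q; rewrite -gmulfV.
by have [gS|gS] := tot g; [left|right]; apply: radical_image.
Qed.

(** In the quotient by gamma n.+2 the image of gamma n.+1 is central and
generated by finitely many commutators. *)
Lemma full_modulo_step n :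
  full_modulo S (gamma n.+1) -> full_modulo S (gamma n.+2).
Proof.
move=> full; apply/full_modulo_quo.
have [L [LP genL]] := lcs_generators genA n.
have imsub : is_subgroup (quo_lcs n.+2 @` gamma n.+1).
  apply: is_subgroupP => [|_ _ [x x1 <-] [y y1 <-]].
    by exists 1; [apply: (sg1 (lcs G n.+1))|].
  exists (x / y); last by rewrite gmulfF.
  by apply: (@sgM _ (lcs G n.+1)) => //; apply: (@sgV _ (lcs G n.+1)).
apply: (@radical_central_extension _ _ _ _ (Subgroup imsub) _ _
  [seq quo_lcs n.+2 v | v <- L]).
- exact: submonoid_image.
- exact: radical_quo_total.
- by move=> _ [z zn <-]; apply: quo_central => g; apply: lcs_comm.
- move=> x; have [g <-] := quo_surj x; have [m [z [zn Sz]]] := full g.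
  exists m, (quo_lcs n.+2 z); split; first by exists z.
  by exists (g ^+ m.+1 * z) => //; rewrite gmulfM gmulfXn.
- move=> _ /mapP[v /LP[v1 [u [h vE]]] ->]; split; first by exists v.
  by exists (quo_lcs n.+2 u), (quo_lcs n.+2 h); rewrite vE gmulfR.
- move=> _ [z /genL Lz <-].
  apply: (@image_generated _ _ (quo_lcs n.+2) ([set` L] `|` gamma n.+2));
    last by exists z.
  move=> _ [x [xL|x2] <-]; first by apply: mem_generated; apply: map_f.
  have x1 : quo_lcs n.+2 x = 1 by apply/esym/quoP; rewrite invg1 mul1g.
  by rewrite /= x1; apply: (sg1 (generated_subgroup _)).
Qed.

Lemma radical_nilpotent : nilpotent_group [set: G] ->
  full_modulo S (gamma 1) -> forall g, radical S g.
Proof.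
move=> [c gc] full.
have fulln n : full_modulo S (gamma n.+1).
  by elim: n => [//|n IHn]; apply: full_modulo_step.
move=> g; have [m [z []]] := fulln c g.
by move=> /lcs_sub; rewrite gc => ->; rewrite mulg1 => Sg; exists m.
Qed.

End Nilpotent.

(** In the abelianization, x^-1 = y (xy)^-1 and y^-1 = (xy)^-1 x are products of
elements of the radical, so all of it is the radical. *)
Lemma radical_two_generated (G : groupType) (S : set G) (x y : G) :
  nilpotent_group [set: G] -> (forall g, generated [set` [:: x; y]] g) ->
  submonoid S -> (forall g, radical S g \/ radical S g^-1) ->
  radical S x -> radical S y -> radical S (x * y)^-1 -> forall g, radical S g.
Proof.
move=> nilG gen SM tot xS yS xyS.
apply: (radical_nilpotent SM tot gen nilG); apply/full_modulo_quo => q.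
have fC (r : quotient_of (@lcs_normal G 1)) : central r.
  by have [g <-] := quo_surj r; apply: quo_central => h; apply: lcs_comm.
have fSM : submonoid (quo_lcs 1 @` S) by apply: submonoid_image.
have fxS : radical (quo_lcs 1 @` S) (quo_lcs 1 x) by apply: radical_image.
have fyS : radical (quo_lcs 1 @` S) (quo_lcs 1 y) by apply: radical_image.
have fxyS : radical (quo_lcs 1 @` S) (quo_lcs 1 x * quo_lcs 1 y)^-1.
  by rewrite -gmulfM -gmulfV; apply: radical_image.
have [g <-] := quo_surj q.
apply: (@radical_generated _ _ fSM [set quo_lcs 1 x; quo_lcs 1 y]).
  move=> _ [->|->]; split; try exact: fC; try by [].
  - rewrite -[_^-1](mulVKg (quo_lcs 1 y)) -invgM.
    exact: radicalM (fC _ _) fyS fxyS.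
  - rewrite -[_^-1](mulgVK (quo_lcs 1 x)) -invgM.
    exact: radicalM (fC _ _) fxyS fxS.
suff : quo_lcs 1 @` generated [set` [:: x; y]] `<=`
    generated [set quo_lcs 1 x; quo_lcs 1 y].
  by apply; exists g.
apply: image_generated => _ [z /= + <-]; rewrite !inE.
by move=> /orP[/eqP->|/eqP->]; apply: mem_generated; [left|right].
Qed.

(** The hypothesis on (xy)^-1 stands for a failure of closure under products;
the conclusion is the contradiction that it leads to when S is the monoid of
nonnegative elements of a left order. It follows from the two-generated case
inside the subgroup generated by x and y. *)
Lemma radical_locally_nilpotent (G : groupType) (S : set G) (x y : G) :
  locally_nilpotent G ->
  submonoid S -> (forall g, radical S g \/ radical S g^-1) ->
  radical S x -> radical S y -> radical S (x * y)^-1 -> radical S x^-1.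
Proof.
move=> lnG SM tot xS yS xyS.
pose A : set G := [set` [:: x; y]]; pose N := generated_subgroup A.
have AN z : A z -> z \in sg_set N.
  by move=> Az; apply: mem_set; apply: mem_generated.
have xN : x \in sg_set N by apply: AN; rewrite /A /= mem_head.
have yN : y \in sg_set N by apply: AN; rewrite /A /= !inE eqxx orbT.
pose X := SgType xN; pose Y := SgType yN.
pose f : sg_type N -> G := val; pose T : set (sg_type N) := f @^-1` S.
have rT u : radical T u <-> radical S (val u).
  by split=> -[n nS]; exists n; move: nS; rewrite /T /= /f gmulfXn.
suff uT : forall u, radical T u.
  by have /rT := uT X^-1; rewrite gmulfV.
apply: (@radical_two_generated _ T X Y).
- have [|n nN] := lnG A; first exact: finite_seq.
  exists n; apply/seteqP; split=> [u un|_ ->].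
    apply: val_inj; rewrite gmulf1.
    have : lower_central N n (val u).
      apply: (@lower_central_morph _ _ (val : UMagmaMorphism.type _ _)) => [v|].
        by apply/set_mem/valP.
      by exists u.
    by rewrite nN.
  exact: (sg1 (lcs (sg_type N) n)).
- move=> u; pose B := generated_subgroup [set` [:: X; Y]].
  have imB : is_subgroup [set g | exists2 v, sg_set B v & val v = g].
    apply: is_subgroupP => [|_ _ [v Bv <-] [w Bw <-]].
      by exists 1; [apply: sg1|].
    by exists (v / w) => //; apply: sgM => //; apply: sgV.
  suff /(_ (val u) (set_mem (valP u))) [v Bv /val_inj <-] :
    generated A `<=` Subgroup imB by [].
  apply: sub_generated => z; rewrite /A /= !inE.
  move=> /orP[/eqP->|/eqP->]; [exists X|exists Y] => //; apply: mem_generated.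
    by rewrite /= mem_head.
  by rewrite /= !inE eqxx orbT.
- split; first by rewrite /T /= /f gmulf1; apply: SM.1.
  by move=> u v uT vT; rewrite /T /= /f gmulfM; apply: SM.2.
- move=> u; have [uS|uS] := tot (val u); [left|right]; apply/rT; exact: uS.
- exact/rT.
- exact/rT.
- by apply/rT; exact: xyS.
Qed.

(** * Left orders and finite-index subgroups *)

Section LeftOrders.
Context (G : groupType).
Implicit Types (o : LO G) (g x y : G).

Lemma LO_ltE o x y : o x y <-> o 1 (x^-1 * y).
Proof.
split=> [/(lo_left x^-1)|/(lo_left x)]; first by rewrite mulVg.
by rewrite mulg1 mulVKg.
Qed.

Lemma LO_total1 o g : g <> 1 -> o 1 g \/ o 1 g^-1.
Proof.
move=> /(lo_total o)[|og]; last by left.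
by rewrite LO_ltE mulg1; right.
Qed.

Lemma LO_asym1 o g : o 1 g -> ~ o 1 g^-1.
Proof.
move=> og ogV; apply: (@lo_irr _ o 1); apply: lo_trans og _.
by apply/LO_ltE; rewrite mulg1.
Qed.

Lemma LO_mul1 o x y : o 1 x -> o 1 y -> o 1 (x * y).
Proof. by move=> ox /(lo_left x); rewrite mulg1; apply: lo_trans. Qed.

Lemma LO_expS o g n : o 1 (g ^+ n.+1) <-> o 1 g.
Proof.
have pos x : o 1 x -> o 1 (x ^+ n.+1).
  by move=> ox; elim: n => [//|m IHm]; rewrite expgS; apply: LO_mul1.
split; last exact: pos.
move=> ogn; have [g1|/(LO_total1 o)[//|/pos]] := pselect (g = 1).
  by move: ogn; rewrite g1 expg1n => /lo_irr.
by rewrite expVgn => /LO_asym1; rewrite invgK.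
Qed.

End LeftOrders.

(** Two powers of g lie in the same coset of H, by the pigeonhole principle. *)
Lemma radical_finite_index (G : groupType) (H : subgroup G) :
  finite_index H -> forall g, radical H g.
Proof.
move=> [_ fin] g.
pose c n := lcoset (g ^+ n) H.
have [i [j [ij e]]] : exists i j, i < j /\ c i = c j.
  apply: contrapT => noij; apply: infinite_nat.
  rewrite -(_ : c @^-1` [set lcoset x H | x in setT] = setT); last first.
    by apply/seteqP; split=> // n _; exists (g ^+ n).
  apply: finite_preimage fin => i j _ _ e; apply: contrapT => /eqP.
  rewrite neq_ltn => /orP[ij|ji]; apply: noij; first by exists i, j.
  by exists j, i.
exists (j - i).-1; rewrite prednK ?subn_gt0 //.
have := (eq_lcosetP _ _ _).1 e; rewrite expgnFr 1?ltnW //.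
suff -> : g ^+ j / g ^+ i = g ^- i * g ^+ j by [].
exact/commuteV/commuteX2.
Qed.

Lemma LO_eq_finite_index (G : groupType) (H : subgroup G) (o o' : LO G) :
  finite_index H -> (forall h, sg_set H h -> o 1 h <-> o' 1 h) -> o = o'.
Proof.
move=> finH oo'; apply: LO_ext => x y; rewrite LO_ltE [o' x y]LO_ltE.
have [n Hn] := radical_finite_index finH (x^-1 * y).
by rewrite -(LO_expS o _ n) -(LO_expS o' _ n); apply: oo'.
Qed.

Lemma LO_res_inj (G : groupType) (H : subgroup G) :
  finite_index H -> injective (@LO_res G H).
Proof.
move=> finH o o' e; apply: (LO_eq_finite_index finH) => h /mem_set hH.
by rewrite -[o 1 h]/(LO_res H o 1 (SgType hH)) e.
Qed.

(** * Extending a left order from a finite-index subgroup *)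

Section Extension.
Context (G : groupType) (tfG : torsion_free G) (lnG : locally_nilpotent G).
Context (H : subgroup G) (finH : finite_index H) (p : LO (sg_type H)).

Definition pos_cone : set G := [set g | exists2 h, val h = g & p 1 h].

Lemma pos_coneM x y : pos_cone x -> pos_cone y -> pos_cone (x * y).
Proof.
by move=> [u <- pu] [v <- pv]; exists (u * v) => //; apply: LO_mul1.
Qed.

Lemma pos_cone_asym x : pos_cone x -> ~ pos_cone x^-1.
Proof.
move=> [u <- pu] [v vu pv]; apply: (LO_asym1 pu).
by rewrite -(_ : v = u^-1) //; apply: val_inj.
Qed.

Lemma pos_cone_total x : sg_set H x -> x <> 1 -> pos_cone x \/ pos_cone x^-1.
Proof.
move=> /mem_set xH x1; pose u := SgType xH.
have [|pu|pu] := @LO_total1 _ p u; first by move=> /(congr1 val).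
- by left; exists u.
- by right; exists u^-1.
Qed.

Lemma radical_pos_asym x : radical pos_cone x -> ~ radical pos_cone x^-1.
Proof.
have expP y n : pos_cone y -> pos_cone (y ^+ n.+1).
  by move=> Py; elim: n => [//|n IHn]; rewrite expgS; apply: pos_coneM.
move=> [n Px] [m Px']; have := pos_cone_asym (expP _ m Px); apply.
by rewrite -expgnA mulnC expgnA -expVgn -expVgn; apply: expP.
Qed.

Lemma radical_pos_total x : x <> 1 ->
  radical pos_cone x \/ radical pos_cone x^-1.
Proof.
move=> x1; have [n Hx] := radical_finite_index finH x.
have [|Px|Px] := pos_cone_total Hx; first by move=> /tfG.
- by left; exists n.
- by right; exists n; rewrite expVgn.
Qed.

(** Adding 1 to the positive cone gives a monoid to which
[radical_locally_nilpotent] applies. If xy were not positive, x^-1 would be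
nonnegative, against the positivity of x. *)
Lemma radical_posM x y : radical pos_cone x -> radical pos_cone y ->
  radical pos_cone (x * y).
Proof.
move=> Px Py; apply: contrapT => nPxy.
pose S : set G := [set g | g = 1 \/ pos_cone g].
have SM : submonoid S.
  split=> [|u v]; first by left.
  move=> [->|Pu] [->|Pv]; rewrite ?mul1g ?mulg1; [left|right..] => //.
  exact: pos_coneM.
have PS g : radical pos_cone g -> radical S g by move=> [n Pg]; exists n; right.
have nS g : radical pos_cone g -> ~ radical S g^-1.
  move=> [n Pg] [m [|Pg']].
    move=> /tfG g1; have := radical_pos_asym (ex_intro _ n Pg).
    by apply; rewrite g1; exists n; move: Pg; rewrite -[g]invgK g1 invg1.
  by apply: (@radical_pos_asym g); [exists n|exists m].
apply: (nS x Px).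
apply: (radical_locally_nilpotent lnG SM _ (PS x Px) (PS y Py)).
  move=> g; have [->|/radical_pos_total[Pg|Pg]] := pselect (g = 1).
  - by left; exists 0; left.
  - by left; apply: PS.
  - by right; apply: PS.
have [->|/radical_pos_total[//|]] := pselect (x * y = 1); last exact: PS.
by exists 0; left; rewrite invg1.
Qed.

Lemma extend_irr x : ~ radical pos_cone (x^-1 * x).
Proof.
by rewrite mulVg => P1; apply: (radical_pos_asym P1); rewrite invg1.
Qed.

Lemma extend_trans x y z : radical pos_cone (x^-1 * y) ->
  radical pos_cone (y^-1 * z) -> radical pos_cone (x^-1 * z).
Proof.
by move=> Pxy Pyz; have := radical_posM Pxy Pyz; rewrite -mulgA mulVKg.
Qed.

Lemma extend_total x y : x <> y ->
  radical pos_cone (x^-1 * y) \/ radical pos_cone (y^-1 * x).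
Proof.
move=> xy; have [|Pxy|] := @radical_pos_total (x^-1 * y).
- by move=> /mulg1_eq; rewrite invgK.
- by left.
- by rewrite invgM invgK; right.
Qed.

Lemma extend_left x y g : radical pos_cone (x^-1 * y) ->
  radical pos_cone ((g * x)^-1 * (g * y)).
Proof. by rewrite invgM -mulgA mulKg. Qed.

Definition LO_extend : LO G :=
  LeftOrder extend_irr extend_trans extend_total extend_left.

Lemma LO_extendK : LO_res H LO_extend = p.
Proof.
apply: LO_ext => u v; rewrite (LO_ltE p) /=.
suff posE w : radical pos_cone (val w) <-> p 1 w.
  by rewrite -posE gmulfM gmulfV.
split=> [[n [h hE ph]]|pw]; last by exists 0, w.
apply/(LO_expS p _ n); rewrite -(_ : h = w ^+ n.+1) //.
by apply: val_inj; rewrite gmulfXn.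
Qed.

End Extension.

Lemma LO_res_bij (G : groupType) (tfG : torsion_free G)
    (lnG : locally_nilpotent G) (H : subgroup G) :
  finite_index H -> bijective (@LO_res G H).
Proof.
move=> finH; exists (LO_extend tfG lnG finH) => [o|p]; last exact: LO_extendK.
by apply: (LO_res_inj finH); rewrite LO_extendK.
Qed.

(** * The action of the commensurator *)

Section Action.
Context (G : groupType).
Hypothesis res_bij : forall H : subgroup G, finite_index H ->
  bijective (@LO_res G H).
Implicit Types (phi psi : commensuration G) (o : LO G).

Lemma comm_actP phi o x y : sg_set (dom phi) x -> sg_set (dom phi) y ->
  comm_act res_bij phi o (cfun phi x) (cfun phi y) <-> o x y.
Proof.
move=> /domP[u <-] /domP[v <-]; rewrite !cfunE.
rewrite -[comm_act _ _ _ _ _]/(LO_res (cod phi) (comm_act res_bij phi o)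
  (phi u) (phi v)).
by rewrite bij_invKV LO_mapE.
Qed.

(** The image of K under phi, which is the preimage of K under the inverse of
phi, has finite index, and an order is determined by its restriction to it. *)
Lemma comm_act_unique phi (K : subgroup G) o o' :
  finite_index K -> K `<=` dom phi ->
  (forall x y, sg_set K x -> sg_set K y ->
    o' (cfun phi x) (cfun phi y) <-> o x y) ->
  o' = comm_act res_bij phi o.
Proof.
move=> finK KD o'E.
apply: (@LO_eq_finite_index _ (Defs.preim (comm_inv phi) K)).
  exact: finite_index_preim.
move=> h [Ch]; rewrite comm_invE //; have [_ hE] := cinv_funP Ch.
move: (cinv_fun phi h) hE => x <- Kx; rewrite -(cfun1 phi).
by rewrite o'E ?comm_actP //; try exact: sg1; apply: KD.
Qed.

Lemma comm_act_equiv phi psi : comm_equiv phi psi ->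
  comm_act res_bij phi =1 comm_act res_bij psi.
Proof.
move=> /comm_equivP[K [finK Kphi Kpsi e]] o.
apply: (comm_act_unique finK Kpsi) => x y Kx Ky.
by rewrite -!e // comm_actP //; apply: Kphi.
Qed.

Lemma comm_act_id o : comm_act res_bij (comm_id G) o = o.
Proof.
apply/esym/(comm_act_unique (@finite_indexT G)) => // x y _ _.
by rewrite !comm_idE.
Qed.

Lemma comm_act_comp phi psi o :
  comm_act res_bij (comm_comp phi psi) o =
  comm_act res_bij psi (comm_act res_bij phi o).
Proof.
apply/esym/(comm_act_unique (comp_dom_fi phi psi)) => // x y xK yK.
have [[Dx Kx] [Dy Ky]] := (xK, yK).
by rewrite !comm_compE // !comm_actP.
Qed.

End Action.

Theorem lemma1p5 (G : groupType) (tfG : torsion_free G)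
    (lnG : locally_nilpotent G) :
  exists res_bij :
      forall H : subgroup G, finite_index H -> bijective (@LO_res G H),
    (forall phi psi : commensuration G, comm_equiv phi psi ->
       comm_act res_bij phi =1 comm_act res_bij psi) /\
    (exists act : LO G -> Comm G -> LO G,
       (forall (phi : commensuration G) (o : LO G),
          act o (\pi_(Comm G) phi) = comm_act res_bij phi o) /\
       is_right_action act).
Proof.
exists (LO_res_bij tfG lnG); split; first exact: comm_act_equiv.
pose act (o : LO G) (a : Comm G) := comm_act (LO_res_bij tfG lnG) (repr a) o.
have actE phi o :
    act o (\pi_(Comm G) phi) = comm_act (LO_res_bij tfG lnG) phi o.
  by apply: comm_act_equiv; apply/comm_piP; rewrite reprK.
exists act; split=> //; split=> [o|o].
  by rewrite actE comm_act_id.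
elim/quotW=> phi; elim/quotW=> psi.
by rewrite Comm_mulE !actE comm_act_comp.
Qed.
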